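(* For $n\geq 1$ let $x_{n,1}<x_{n,2}<\dots<x_{n,n}=0$ be the $n$ (real, distinct) roots of the Eulerian polynomial $A_n(x)=\sum_{k=1}^n A(n,k)x^k$, and set $u_{n,k}=\frac{1}{1-x_{n,k}}\in(0,1]$. Then for any integers $1\leq p\leq n$, $$\frac{1}{n+1}\sum_{k=1}^n u_{n,k}^p=\frac{(-1)^pN_p}{p!},$$ where $N_p=\int_0^1 (x-1)(x-2)\cdots(x-p)\,dx$ is the $p$-th Nörlund number.
   Context: For $1\leq k\leq n$, $A(n,k)$ denotes the Eulerian number, i.e. the number of permutations of $\{1,\dots,n\}$ with exactly $k-1$ descents. It is a classical fact that $A_n(x)=\sum_{k=1}^n A(n,k)x^k$ has $n$ distinct real roots, all nonpositive, the largest being $0$. *)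

(* Defs.v *)
From HB Require Import structures.
From mathcomp Require Import all_boot all_order all_fingroup all_algebra.
From mathcomp Require Import all_classical all_reals all_analysis.

Set Implicit Arguments.
Unset Strict Implicit.
Unset Printing Implicit Defensive.

Import Order.TTheory GRing.Theory Num.Theory.
Import numFieldNormedType.Exports.

Local Open Scope classical_set_scope.
Local Open Scope ring_scope.

(* Permutations of {1, ..., n} are encoded as permutations of
   'I_n = {0, ..., n - 1}; i is a descent of s when i + 1 < n and
   s (i + 1) < s i. *)
Definition descents (n : nat) (s : {perm 'I_n}) : nat :=
  #|[pred i : 'I_n | [exists j : 'I_n, (j == i.+1 :> nat) && (s j < s i)%N]]|.

(* (descents s).+1 == k rather than descents s == k.-1: the latter would not
   give A(n, 0) = 0, since 0.-1 = 0. *)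
Definition eulerian (n k : nat) : nat :=
  #|[pred s : {perm 'I_n} | (descents s).+1 == k]|.

Definition eulerian_poly (R : realType) (n : nat) : {poly R} :=
  \sum_(1 <= k < n.+1) (eulerian n k)%:R *: 'X^k.

Definition norlund (R : realType) (p : nat) : R :=
  \int[@lebesgue_measure R]_(t in `[0, 1]) \prod_(1 <= i < p.+1) (t - i%:R).

(* Main.v *)
Require Import Defs.
From HB Require Import structures.
From mathcomp Require Import all_boot all_order all_fingroup all_algebra.
From mathcomp Require Import all_classical all_reals all_analysis.
From mathcomp Require Import ring zify.

Set Implicit Arguments.
Unset Strict Implicit.
Unset Printing Implicit Defensive.

Import Order.TTheory GRing.Theory Num.Theory.
Import numFieldNormedType.Exports.

Local Open Scope ring_scope.

(** Put t = 1 - x and L(t) = -log(1 - t) / t. The Eulerian recurrence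
    A_(n+1) = (n + 1) x A_n + x (1 - x) A_n' gives
    A_n(1 - t) L(t)^(n+1) = n! + O(t^(n+1)), while A_n(1 - t) is a constant
    times the product of the 1 - u_k t. Comparing logarithmic derivatives, the
    generating function of the power sums of the u_k is (n + 1) L' / L up to
    O(t^n). On the other side, (1 - t)^(x-1) has coefficients
    (-1)^p (x - 1) ... (x - p) / p!, and integrating it over x in [0, 1] gives
    1 / ((1 - t) L) = (t L)' / L = 1 + t L' / L. *)

(** * Descents and insertion of the largest letter *)

Lemma descentsE (n : nat) (s : {perm 'I_n.+1}) :
  descents s = (\sum_(0 <= i < n) (s (inord i.+1) < s (inord i))%N)%N.
Proof.
rewrite /descents -sum1_card big_mkcond /= big_mkord big_ord_recr /=.
rewrite [X in (_ + X)%N]ifN ?addn0; last first.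
  rewrite inE; apply/existsP => -[j /andP[/eqP jn _]].
  by have := ltn_ord j; rewrite jn /= ltnn.
apply: eq_bigr => i _; rewrite inE /=.
have iS : inord i = widen_ord (leqnSn n) i.
  by apply: val_inj; rewrite /= inordK // ltnS ltnW.
rewrite iS; case: existsP => [[j /andP[/eqP ji]]|].
  by rewrite -[i.+1]ji inord_val => ->.
case: ltnP => // h []; exists (inord i.+1).
by rewrite inordK ?ltnS // eqxx.
Qed.

Definition insert_word (w : nat -> nat) (m N k : nat) : nat :=
  if (k < m)%N then w k else if k == m then N else w k.-1.

(* Inserting a letter larger than all others destroys the descent at the
   insertion point, if any, and creates one unless it is inserted last. *)
Lemma insert_word_descents (w : nat -> nat) (m N n : nat) :
  (forall k, w k < N)%N -> (m <= n.+1)%N ->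
  ((\sum_(0 <= k < n.+1) (insert_word w m N k.+1 < insert_word w m N k)) +
     (0 < m <= n)%N * (w m < w m.-1)
   = (\sum_(0 <= k < n) (w k.+1 < w k)) + (m <= n))%N.
Proof.
move=> wN.
have wNF k : (N < w k)%N = false by apply/negbTE; rewrite -leqNgt ltnW.
have lastE : ((\sum_(0 <= k < n.+1)
    (insert_word w n.+1 N k.+1 < insert_word w n.+1 N k))
   = (\sum_(0 <= k < n) (w k.+1 < w k)))%N.
  rewrite big_nat_recr //= {3 4}/insert_word ltnn eqxx ltnSn wNF addn0.
  apply: eq_big_nat => k /andP[_ kn].
  by rewrite /insert_word !ltnS kn (ltnW kn).
rewrite leq_eqVlt => /predU1P[->|].
  by rewrite ltnn andbF mul0n !addn0 lastE.
rewrite ltnS => mn; move: lastE => _.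
elim: n mn => [|n IHn].
  rewrite leqn0 => /eqP ->.
  by rewrite big_nat1 big_geq // /insert_word /= wN.
rewrite leq_eqVlt => /predU1P[->|].
  rewrite big_nat_recr // big_nat_recr //= [in RHS]big_nat_recr //=.
  have -> : (\sum_(0 <= k < n)
     (insert_word w n.+1 N k.+1 < insert_word w n.+1 N k)
     = \sum_(0 <= k < n) (w k.+1 < w k))%N.
    apply: eq_big_nat => k /andP[_ kn].
    by rewrite /insert_word !ltnS kn (ltnW kn).
  have -> : insert_word w n.+1 N n = w n by rewrite /insert_word ltnSn.
  have -> : insert_word w n.+1 N n.+1 = N by rewrite /insert_word ltnn eqxx.
  have -> : insert_word w n.+1 N n.+2 = w n.+1.
    by rewrite /insert_word ltnNge leqnSn /= gtn_eqF.
  rewrite wN wNF; lia.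
rewrite ltnS => mn; have := IHn mn.
move=> IH; rewrite big_nat_recr //= [in RHS]big_nat_recr //=.
have -> : insert_word w m N n.+2 = w n.+1.
  by rewrite /insert_word ltnNge (leqW (leqW mn)) /= gtn_eqF // ltnS leqW.
have -> : insert_word w m N n.+1 = w n.
  by rewrite /insert_word ltnNge (leqW mn) /= gtn_eqF.
by move: IH; lia.
Qed.

(** As a word, [lift_perm m ord_max s] is [s] with a new largest letter inserted at position [m]. *)
Lemma descents_lift_perm (n : nat) (s : {perm 'I_n.+1}) (m : 'I_n.+2) :
  (descents (lift_perm m ord_max s)
     + (0 < m <= n)%N * (s (inord m) < s (inord m.-1))
   = descents s + (m <= n))%N.
Proof.
pose w k : nat := s (inord k).
have wN k : (w k < n.+1)%N by exact: ltn_ord.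
rewrite !descentsE -(insert_word_descents wN) ?leq_ord //.
congr addn; apply: eq_big_nat => k /andP[_ kn].
have liftE j : (j < n.+2)%N ->
    lift_perm m ord_max s (inord j) = insert_word w m n.+1 j :> nat.
  move=> jn; rewrite /insert_word.
  case: (unliftP m (inord j)) => [i|] /(congr1 val) /=; rewrite inordK // => jE.
    have -> : inord j = lift m i by apply: val_inj; rewrite /= inordK.
    rewrite lift_perm_lift /= /bump leqNgt ltn_ord add0n jE /bump.
    case: (leqP m i) => [mi|im]; rewrite ?add1n ?add0n.
      by rewrite ltnNge leqW //= gtn_eqF // /w inord_val.
    by rewrite im /w inord_val.
  have -> : inord j = m by apply: val_inj; rewrite /= inordK.
  by rewrite lift_perm_id jE ltnn eqxx.
by rewrite !liftE // ltnW.
Qed.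

(** The position of the largest value and the remaining word can be read back, and (n + 1) n! = (n +
    1)!. *)
Lemma lift_perm_max_bij (n : nat) :
  bijective (fun p : 'I_n.+1 * {perm 'I_n} => lift_perm p.1 ord_max p.2).
Proof.
apply: inj_card_bij; last first.
  by rewrite card_prod !card_Sn card_ord factS.
move=> [i s] [j t] /= E.
have ij : i = j.
  apply: (@perm_inj _ (lift_perm i ord_max s)).
  by rewrite lift_perm_id E lift_perm_id.
congr pair => //; apply/permP => k; apply: (@lift_inj _ ord_max).
by rewrite -(lift_perm_lift i) E ij lift_perm_lift.
Qed.

(** * The recurrence for Eulerian polynomials *)

Section EulerianRecurrence.
Variable R : realType.

(** Agrees with [eulerian_poly] only from index 1 on: [eulerian_poly R 0] is an empty sum. *)
Fixpoint eulerian_rec (n : nat) : {poly R} :=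
  if n is m.+1 then
    (m.+1)%:R * 'X * eulerian_rec m + 'X * (1 - 'X) * (eulerian_rec m)^`()
  else 1.

Lemma eulerian_poly_descents (n : nat) :
  eulerian_poly R n.+1 = \sum_(s : {perm 'I_n.+1}) 'X^((descents s).+1).
Proof.
rewrite /eulerian_poly.
have dS (s : {perm 'I_n.+1}) : (descents s < n.+1)%N.
  rewrite descentsE ltnS big_mkord.
  by rewrite (leq_trans (leq_sum _ (fun i _ => leq_b1 _))) // sum1_card card_ord.
rewrite big_add1 /= big_mkord.
under eq_bigr => k _.
  rewrite /eulerian -sum1_card natr_sum scaler_suml.
  under eq_bigr => s /eqP E do rewrite scale1r -E.
  over.
by rewrite [RHS](partition_big (fun s => Ordinal (dS s)) xpredT) //.
Qed.

(** If [s] has d descents, d + 1 of the n + 2 insertions (inside a descent or at the end) keep d,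
    and the other n + 1 - d raise it by one. *)
Lemma sum_lift_perm_descents (n : nat) (s : {perm 'I_n.+1}) :
  \sum_(m < n.+2) 'X^((descents (lift_perm m ord_max s)).+1) =
  (n.+2)%:R * 'X * 'X^((descents s).+1)
    + 'X * (1 - 'X) * ('X^((descents s).+1))^`() :> {poly R}.
Proof.
set d := descents s.
pose b k : bool := (s (inord k.+1) < s (inord k))%N.
have dE : d%:R = \sum_(k < n) (b k)%:R :> {poly R}.
  by rewrite /d descentsE natr_sum big_mkord.
have termE (m : 'I_n.+2) : 'X^((descents (lift_perm m ord_max s)).+1) =
    'X^(d.+1) * (if (m <= n)%N then
      'X + ((0 < m)%N && b m.-1)%:R * (1 - 'X) else 1) :> {poly R}.
  have := descents_lift_perm s m; rewrite -/d.
  case: (leqP m n) => mn; last first.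
    by rewrite andbF mul0n !addn0 => ->; rewrite mulr1.
  rewrite andbT /b; case: (posnP m) => [->|m0] /=.
    by rewrite mul0n addn0 addn1 => ->; rewrite mul0r addr0 exprSr.
  rewrite prednK // mul1n; case: (_ < _)%N => /=; rewrite ?addn0 !addn1.
    by case=> ->; rewrite mul1r addrC subrK mulr1.
  by move=> ->; rewrite mul0r addr0 exprSr.
rewrite (eq_bigr _ (fun m _ => termE m)) -mulr_sumr big_ord_recr /= ltnn.
under eq_bigr => m _ do rewrite -ltnS ltn_ord.
rewrite big_split /= sumr_const card_ord -mulr_suml big_ord_recl /= add0r.
rewrite (_ : \sum_(i < n) _ = d%:R); last by rewrite dE; exact: eq_bigr.
rewrite derivXn /= -mulr_natl -[_ *+ d.+1]mulr_natl exprS.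
ring.
Qed.

Lemma eulerian_poly_rec (n : nat) : eulerian_poly R n.+1 = eulerian_rec n.+1.
Proof.
elim: n => [|n IHn].
  rewrite eulerian_poly_descents /= derivC mulr0 addr0 mulr1 mul1r.
  rewrite (big_pred1 1%g) => [|s]; last first.
    by rewrite !inE; apply/esym/eqP/permP => i; rewrite !ord1.
  by rewrite descentsE big_geq.
rewrite eulerian_poly_descents.
rewrite (reindex _ (onW_bij _ (lift_perm_max_bij n.+1))) /=.
rewrite -(pair_bigA _ (fun m s => 'X^((descents (lift_perm m ord_max s)).+1))).
rewrite exchange_big /= (eq_bigr _ (fun s _ => sum_lift_perm_descents s)).
rewrite big_split /= -!mulr_sumr -[X in _ + _ * X]raddf_sum.
rewrite -eulerian_poly_descents.
by rewrite -/(eulerian_rec n.+1) IHn.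
Qed.

End EulerianRecurrence.

(** * Power series as polynomials modulo a power of X *)

Section TruncatedSeries.
Variable F : numFieldType.
Implicit Types p q : {poly F}.

Lemma dvdXn_deriv n p : 'X^(n.+1) %| p -> 'X^n %| p^`().
Proof.
move=> /dvdpP[q ->]; rewrite derivM derivXn /= dvdp_add //.
  by rewrite dvdp_mull // dvdp_exp2l.
by rewrite dvdp_mull // -mulr_natl dvdp_mull.
Qed.

(** Such a [q] is a unit among power series, so it can be cancelled. *)
Lemma dvdXn_mull n q p : q.[0] != 0 -> ('X^n %| q * p) = ('X^n %| p).
Proof.
move=> q0; rewrite Gauss_dvdpr // coprimep_expl // coprimep_sym coprimepX.
by rewrite rootE.
Qed.

Lemma dvdXn_coef n p i : 'X^n %| p -> (i < n)%N -> p`_i = 0.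
Proof. by move=> /dvdpP[q ->] lt_in; rewrite coefMXn lt_in. Qed.

Lemma dvdXnP n p : (forall i, (i < n)%N -> p`_i = 0) -> 'X^n %| p.
Proof.
move=> p0; rewrite -(poly_take_drop n p) (_ : take_poly n p = 0).
  by rewrite add0r dvdp_mull.
by apply/polyP => i; rewrite coef_take_poly coef0; case: ifP => // /p0.
Qed.

(* The truncation of the power series -log(1 - X) / X. *)
Definition log_trunc (M : nat) : {poly F} := \poly_(i < M) (i.+1%:R)^-1.

Lemma log_trunc0 M : (log_trunc M.+1).[0] = 1.
Proof. by rewrite horner_coef0 coef_poly /= invr1. Qed.

Lemma deriv_XlogE M : ('X * log_trunc M)^`() = \poly_(i < M) 1.
Proof.
apply/polyP => i; rewrite coef_deriv coefXM /= !coef_poly.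
by case: ifP => _; rewrite ?mul0rn // -[LHS]mulr_natr mulVf // pnatr_eq0.
Qed.

(** Truncation of (-log(1 - t))' = 1 / (1 - t), with its exact error. *)
Lemma deriv_Xlog M : (1 - 'X) * ('X * log_trunc M)^`() = 1 - 'X^M.
Proof.
rewrite deriv_XlogE poly_def -opprB mulNr -[RHS]opprB subrX1.
by under eq_bigr do rewrite scale1r.
Qed.

(* Newton's identities, as the logarithmic derivative of the product. *)
Lemma newton_dvdXn (I : Type) (s : seq I) (u : I -> F) N :
  'X^N %| (\prod_(k <- s) (1 - (u k)%:P * 'X))^`()
    + (\prod_(k <- s) (1 - (u k)%:P * 'X))
      * \poly_(p < N) (\sum_(k <- s) u k ^+ p.+1).
Proof.
elim: s => [|k s IHs].
  rewrite !big_nil derivC add0r mul1r; apply: dvdXnP => i iN.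
  by rewrite coef_poly iN big_nil.
rewrite !big_cons; set a := 1 - _; set B := \prod_(_ <- _) _ in IHs *.
set S := \poly_(p < N) _ in IHs; pose T : {poly F} := \poly_(p < N) u k ^+ p.+1.
have -> : \poly_(p < N) (\sum_(j <- k :: s) u j ^+ p.+1) = T + S.
  apply/polyP => i; rewrite coefD !coef_poly big_cons.
  by case: ifP; rewrite ?addr0.
(* Here [T] is a truncated geometric series for u / (1 - u t), that is, for minus the logarithmic
   derivative of [a]. *)
have aT : a^`() + a * T = - (u k ^+ N.+1)%:P * 'X^N.
  have -> : T = (u k)%:P * \sum_(i < N) ((u k)%:P * 'X) ^+ i.
    rewrite /T poly_def mulr_sumr; apply: eq_bigr => i _.
    by rewrite exprMn mulrA -rmorphXn -rmorphM -exprS -mul_polyC.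
  rewrite /a derivB derivC derivM derivC derivX mul0r !add0r mulr1.
  rewrite mulrCA -opprB mulNr -subrX1 exprMn exprS rmorphM rmorphXn; ring.
rewrite derivM (_ : _ + _ = a * (B^`() + B * S) + B * (a^`() + a * T)).
  by rewrite dvdp_add ?dvdp_mull // aT dvdp_mull.
ring.
Qed.

End TruncatedSeries.

(** * Eulerian polynomials expanded at x = 1 *)

Section EulerianAtOne.
Variable R : realType.
Local Notation eulerian_rec := (eulerian_rec R).
Local Notation C n := (eulerian_rec n \Po (1 - 'X)).

(** Under x = 1 - t the chain rule turns x (1 - x) d/dx into -t (1 - t) d/dt. *)
Lemma eulerian_rec_comp n :
  C n.+1 = (1 - 'X) * (n.+1%:R * C n - 'X * (C n)^`()).
Proof.
rewrite /= comp_polyD !comp_polyM comp_polyB comp_polyX -!polyC1 comp_polyC.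
rewrite deriv_comp derivB derivC derivX polyC1 -(rmorph_nat (@polyC R)).
rewrite comp_polyC rmorph_nat; ring.
Qed.

Lemma eulerian_rec_comp0 n : (C n).[0] = n`!%:R.
Proof.
elim: n => [|n IHn]; first by rewrite /= -polyC1 comp_polyC hornerC.
rewrite eulerian_rec_comp !(hornerM, hornerD, hornerN, hornerX, hornerC) IHn.
rewrite -(rmorph_nat (@polyC R)) hornerC factS natrM; ring.
Qed.

(* With t = 1 - x, this says that A_n(x) / n! = (t / -log(1 - t))^(n + 1)
   up to O(t^(n + 1)). The term of order n + 1 of the error is killed by the
   operator f |-> (n + 1) f - t f' of the recurrence. *)
Lemma eulerian_rec_asymptotics M n : (n < M)%N ->
  'X^(n.+1) %| C n * log_trunc R M ^+ n.+1 - n`!%:R.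
Proof.
elim: n => [|n IHn] nM.
  apply: dvdXnP => -[] // _; rewrite -horner_coef0 /= -polyC1 comp_polyC.
  rewrite polyC1 mul1r expr1 hornerD hornerN hornerC.
  by case: M nM => // M _; rewrite log_trunc0 subrr.
have /dvdpP[Q EQ] := IHn (ltnW nM).
set L := log_trunc R M in EQ *.
have L0 : L.[0] = 1 by rewrite /L; case: (M) nM => // M' _; rewrite log_trunc0.
have /dvdpP[K KE] : 'X %| L - 1.
  by rewrite -['X]expr1; apply: dvdXnP => -[] // _;
     rewrite -horner_coef0 hornerD hornerN hornerC L0 subrr.
have E' : (C n)^`() * L ^+ n.+1 + C n * (n.+1%:R * (L^`() * L ^+ n))
    = Q^`() * 'X^(n.+1) + Q * (n.+1%:R * 'X^n).
  have := congr1 (@deriv R) EQ.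
  rewrite derivB derivM deriv_exp /= derivMn derivC mul0rn subr0.
  by rewrite derivM derivXn /= !mulr_natl.
have XL : (1 - 'X) * (L + 'X * L^`()) = 1 - 'X^M.
  by rewrite -deriv_Xlog -/L derivM derivX mul1r.
have LE : L = 1 + K * 'X by rewrite -KE addrC subrK.
have CL : C n * L ^+ n.+1 = n`!%:R + Q * 'X^(n.+1) by rewrite -EQ [RHS]addrC subrK.
rewrite eulerian_rec_comp factS natrM.
have -> : (1 - 'X) * (n.+1%:R * C n - 'X * (C n)^`()) * L ^+ n.+2
    - n.+1%:R * n`!%:R =
  n.+1%:R * (C n * L ^+ n.+1) * ((1 - 'X) * (L + 'X * L^`()))
  - 'X * (1 - 'X) * L * ((C n)^`() * L ^+ n.+1
      + C n * (n.+1%:R * (L^`() * L ^+ n))) - n.+1%:R * n`!%:R.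
  rewrite !exprS; ring.
rewrite XL E' CL.
(* The terms of order n + 1 in [Q] combine with factor [1 - (1 - 'X) * L], a multiple of ['X] since
   [L] is 1 at 0. The ['X^M] term is harmless as [n.+1 < M]. *)
have -> : n.+1%:R * (n`!%:R + Q * 'X^(n.+1)) * (1 - 'X^M)
   - 'X * (1 - 'X) * L * (Q^`() * 'X^(n.+1) + Q * (n.+1%:R * 'X^n))
   - n.+1%:R * n`!%:R =
   (n.+1%:R * Q * (1 - K + K * 'X) - (1 - 'X) * L * Q^`()) * 'X^(n.+2)
   - n.+1%:R * (n`!%:R + Q * 'X^(n.+1)) * 'X^M.
  rewrite LE !exprS; ring.
by apply: dvdp_sub; apply: dvdp_mull => //; exact: dvdp_exp2l.
Qed.

End EulerianAtOne.

(** * Nörlund numbers and their generating function *)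

Section Norlund.
Variable R : realType.

(* The coefficient of t^p in (1 - t)^(x - 1), as a polynomial in x. *)
Definition binom_poly (p : nat) : {poly R} :=
  \prod_(i < p) (1 - (i.+1%:R^-1)%:P * 'X).

Lemma binom_polyS p :
  p.+1%:R * binom_poly p.+1 = (p.+1%:R - 'X) * binom_poly p.
Proof.
rewrite /binom_poly big_ord_recr /= mulrCA mulrBr mulr1 mulrA.
rewrite -(rmorph_nat (@polyC R)) -rmorphM divff ?pnatr_eq0 //.
by rewrite rmorph1 mul1r mulrC.
Qed.

(* Differentiating (1 - t)^(x - 1) in x multiplies it by log(1 - t). *)
Lemma deriv_binom_poly m : (binom_poly m.+1)^`() =
  - \sum_(i < m.+1) ((m.+1 - i)%:R^-1 : R) *: binom_poly i.
Proof.
elim: m => [|m IHm].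
  rewrite big_ord1 /binom_poly big_ord1 big_ord0 invr1 scale1r mul1r.
  by rewrite derivB derivC derivX sub0r.
have nz : (m.+2%:R : {poly R}) != 0.
  by rewrite -(rmorph_nat (@polyC R)) polyC_eq0 pnatr_eq0.
apply: (mulfI nz).
have -> : m.+2%:R * (binom_poly m.+2)^`()
    = - binom_poly m.+1 + (m.+2%:R - 'X) * (binom_poly m.+1)^`().
  have := congr1 (@deriv R) (binom_polyS m.+1).
  rewrite !derivM -(rmorph_nat (@polyC R)) derivB !derivC derivX mul0r add0r.
  by move=> ->; rewrite sub0r mulN1r.
rewrite IHm mulrN [in LHS]mulr_sumr mulrN [in RHS]big_ord_recl /=.
rewrite subn0 mulrDr.
(* Writing m + 2 - X = (i + 1 - X) + (m + 1 - i) makes [binom_polyS] applicable; what is left over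
   telescopes. *)
have termE (i : 'I_m.+1) :
    (m.+2%:R - 'X) * (((m.+1 - i)%:R^-1 : R) *: binom_poly i) =
    m.+2%:R * (((m.+2 - lift ord0 i)%:R^-1 : R) *: binom_poly (lift ord0 i))
    - (binom_poly i.+1 - binom_poly i).
  have iE : (m.+1 - i)%:R = m.+1%:R - i%:R :> R by rewrite natrB // ltnW.
  have iz : (m.+1 - i)%:R != 0 :> R by rewrite pnatr_eq0 -lt0n subn_gt0.
  rewrite lift0 subSS -!mul_polyC.
  set c := ((m.+1 - i)%:R^-1)%:P.
  have cE : c * (m.+1%:R - i%:R) = 1.
    rewrite /c -!(rmorph_nat (@polyC R)) -rmorphB -rmorphM -iE mulVf //.
  have bS := binom_polyS i.
  have -> : (m.+2%:R - 'X) * (c * binom_poly i) =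
     c * ((i.+1%:R - 'X) * binom_poly i)
     + c * (m.+1%:R - i%:R) * binom_poly i by ring.
  rewrite -bS.
  have -> : m.+2%:R * (c * binom_poly i.+1) = c * (i.+1%:R * binom_poly i.+1)
     + c * (m.+1%:R - i%:R) * binom_poly i.+1 by ring.
  rewrite cE; ring.
rewrite (eq_bigr _ (fun i _ => termE i)) sumrB -mulr_sumr.
rewrite -(big_mkord xpredT (fun i => binom_poly i.+1 - binom_poly i)).
rewrite telescope_sumr // -!mul_polyC.
rewrite mulrA -(rmorph_nat (@polyC R)) -rmorphM divff ?pnatr_eq0 //.
rewrite rmorph1; ring.
Qed.

(** At [i = 0] the division by zero gives 0, so the constant term vanishes. *)
Definition primitive (p : {poly R}) : {poly R} :=
  \poly_(i < (size p).+1) (p`_i.-1 / i%:R).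

Lemma deriv_primitive p : (primitive p)^`() = p.
Proof.
apply/polyP => i; rewrite coef_deriv coef_poly ltnS /=.
case: ltnP => [_|/leq_sizeP ->] //; last by rewrite mul0rn.
by rewrite -[LHS]mulr_natr divfK // pnatr_eq0.
Qed.

Definition poly_integral (p : {poly R}) : R :=
  \int[@lebesgue_measure R]_(t in `[0, 1]%classic) p.[t].

Lemma poly_integral_deriv (q : {poly R}) :
  poly_integral q^`() = q.[1] - q.[0].
Proof.
rewrite /poly_integral /Rintegral (@continuous_FTC2 _ _ (horner q)) ?ltr01 //.
- by apply: continuous_subspaceT => z; exact: continuous_horner.
- split.
  + by move=> z _; exact: derivable_horner.
  + by apply: cvg_at_right_filter; exact: continuous_horner.
  + by apply: cvg_at_left_filter; exact: continuous_horner.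
- by move=> z _; rewrite derivE.
Qed.

(** Linearity is read off primitives, which avoids a separate integrability argument. *)
Lemma poly_integral_sum (I : Type) (s : seq I) (a : I -> R)
    (p : I -> {poly R}) :
  poly_integral (\sum_(i <- s) a i *: p i)
    = \sum_(i <- s) a i * poly_integral (p i).
Proof.
have -> : \sum_(i <- s) a i *: p i =
    (\sum_(i <- s) a i *: primitive (p i))^`().
  by rewrite raddf_sum; apply: eq_bigr => i _; rewrite /= derivZ deriv_primitive.
rewrite poly_integral_deriv !horner_sum -sumrB; apply: eq_bigr => i _.
by rewrite !hornerZ -mulrBr -poly_integral_deriv deriv_primitive.
Qed.

Lemma norlund_binom_poly p :
  poly_integral (binom_poly p) = (-1) ^+ p * norlund R p / p`!%:R.
Proof.
(* A sum over one element, so that [poly_integral_sum] extracts the scalar. *)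
have -> : binom_poly p = \sum_(i <- [:: tt]) ((-1) ^+ p / p`!%:R : R) *:
    \prod_(1 <= i < p.+1) ('X - (i%:R)%:P).
  rewrite big_seq1 big_add1 big_mkord /binom_poly.
  rewrite fact_prod big_add1 big_mkord natr_prod -prodfV.
  rewrite -[p in (-1) ^+ p]card_ord -prodr_const -big_split /=.
  rewrite -mul_polyC rmorph_prod -big_split /=; apply: eq_bigr => i _.
  by rewrite mulN1r rmorphN mulNr -mulrN opprB mulrBr -rmorphM mulVf //.
rewrite poly_integral_sum big_seq1 mulrAC; congr (_ * _ / _).
rewrite /poly_integral /norlund; apply: eq_Rintegral => t _.
by rewrite horner_prod; apply: eq_bigr => i _; rewrite hornerXsubC.
Qed.

(** Coefficientwise form of G L = 1 / (1 - t). By [deriv_binom_poly] the sum is the value of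
    [binom_poly] at 0, which is 1, minus that at 1, where the first factor vanishes. *)
Lemma sum_integral_binom_poly m :
  \sum_(i < m.+1) (m.+1 - i)%:R^-1 * poly_integral (binom_poly i) = 1.
Proof.
rewrite -poly_integral_sum -[X in poly_integral X]opprK -deriv_binom_poly.
rewrite -derivN poly_integral_deriv !hornerN opprK addrC !horner_prod.
rewrite big1 => [|i _]; last by rewrite !hornerE ?mulr0 ?subr0.
by rewrite big_ord_recl /= !hornerE invr1 ?mulr1 subrr mul0r subr0.
Qed.

End Norlund.

(** * Comparison of the two generating functions *)

(* The series G of the integrals of [binom_poly] satisfies G * L = (X * L)^`()
   for L = -log(1 - X) / X; here G = 1 + X * G1. *)
Lemma integral_binom_poly_dvdXn (R : realType) n :
  'X^n %| (\poly_(p < n) poly_integral (binom_poly R p.+1)) * log_trunc R n.+1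
    - (log_trunc R n.+1)^`().
Proof.
apply: dvdXnP => i lt_in.
have g0 := sum_integral_binom_poly R 0.
rewrite big_ord1 /= subn0 invr1 mul1r in g0.
rewrite coefB coefM coef_deriv coef_poly ltnS lt_in.
(* Splitting off the constant term 1 of G leaves 1 - 1 / (i + 2) = (i + 1) / (i + 2), a coefficient
   of L'. *)
have := sum_integral_binom_poly R i.+1; rewrite big_ord_recl /= g0 mulr1 subn0.
under eq_bigr => j _ do rewrite /bump leq0n add1n subSS.
under [X in _ -> X - _ = _]eq_bigr => j _.
  rewrite !coef_poly (leq_ltn_trans (leq_ord j) lt_in).
  rewrite ltnS (leq_trans (leq_subr _ _) (ltnW lt_in)) -subSn ?leq_ord //.
  rewrite mulrC; over.
move=> /(canRL (addKr _)) ->.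
by field; rewrite -(natrD _ 2 i) pnatr_eq0.
Qed.

(** Modulo X^n, C' / C is -(n + 1) L' / L by the asymptotics and -S by Newton's identities, while L'
    / L = G; denominators are cleared throughout. *)
Lemma eulerian_power_sums (R : realType) n (u : 'I_n -> R) (c : R) :
  eulerian_rec R n \Po (1 - 'X) = c%:P * \prod_(k < n) (1 - (u k)%:P * 'X) ->
  forall p, (p < n)%N ->
  \sum_(k < n) u k ^+ p.+1 = n.+1%:R * poly_integral (binom_poly R p.+1).
Proof.
set C := _ \Po _; set B := \prod_(_ < _) _ => CB p lt_pn.
pose L := log_trunc R n.+1.
pose S : {poly R} := \poly_(p < n) (\sum_(k < n) u k ^+ p.+1).
pose G : {poly R} := \poly_(p < n) poly_integral (binom_poly R p.+1).
have L0 : L.[0] != 0 by rewrite log_trunc0 oner_eq0.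
have C0 : C.[0] != 0 by rewrite eulerian_rec_comp0 pnatr_eq0 -lt0n fact_gt0.
have dvdCL : 'X^n %| C^`() * L + n.+1%:R * C * L^`().
  have := dvdXn_deriv (eulerian_rec_asymptotics R (ltnSn n)).
  rewrite -/C -/L derivB derivMn derivC mul0rn subr0 derivM deriv_exp /=.
  rewrite -mulr_natl.
  have -> : C^`() * L ^+ n.+1 + C * (n.+1%:R * (L^`() * L ^+ n)) =
      L ^+ n * (C^`() * L + n.+1%:R * C * L^`()) by rewrite exprS; ring.
  by rewrite dvdXn_mull // horner_exp expf_neq0.
have dvdCS : 'X^n %| C^`() + C * S.
  rewrite CB derivM derivC mul0r add0r -mulrA -mulrDr.
  by apply: dvdp_mull; exact: newton_dvdXn.
have dvdLS : 'X^n %| n.+1%:R * L^`() - L * S.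
  rewrite -(dvdXn_mull _ _ C0).
  have -> : C * (n.+1%:R * L^`() - L * S) =
      (C^`() * L + n.+1%:R * C * L^`()) - L * (C^`() + C * S) by ring.
  by apply: dvdp_sub => //; exact: dvdp_mull.
have : 'X^n %| n.+1%:R * G - S.
  rewrite -(dvdXn_mull _ _ L0).
  have -> : L * (n.+1%:R * G - S) =
      (n.+1%:R * L^`() - L * S) + n.+1%:R * (G * L - L^`()) by ring.
  by apply: dvdp_add => //; apply: dvdp_mull; exact: integral_binom_poly_dvdXn.
move=> /dvdXn_coef /(_ lt_pn) /eqP.
rewrite coefB mulr_natl coefMn !coef_poly lt_pn subr_eq0 => /eqP <-.
by rewrite mulr_natl.
Qed.

(** * Factorisation over the roots *)

Lemma size_eulerian_poly (R : realType) n :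
  (size (eulerian_poly R n) <= n.+1)%N.
Proof.
rewrite /eulerian_poly big_add1 big_mkord.
apply: (leq_trans (size_sum _ _ _)); apply/bigmax_leqP => k _.
by rewrite (leq_trans (size_scale_leq _ _)) // size_polyXn ltnS.
Qed.

(* With 0-based indices, x k is the root x_{n,k+1}. *)
Theorem theorem2 (R : realType) (n : nat) (hn : (1 <= n)%N) (x : 'I_n -> R)
  (x_incr : forall i j : 'I_n, (i < j)%N -> x i < x j)
  (x_roots : forall y : R, root (eulerian_poly R n) y <-> exists k, y = x k)
  (x_last : forall k : 'I_n, k.+1 = n -> x k = 0) :
  let u := fun k : 'I_n => 1 / (1 - x k) in
  (forall k : 'I_n, 0 < u k <= 1) /\
  (forall p : nat, (1 <= p <= n)%N ->
    1 / (n.+1)%:R * \sum_(k < n) u k ^+ p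
      = (-1) ^+ p * norlund R p / (p`!)%:R).
Proof.
move=> u; case: n hn x x_incr x_roots x_last @u => // n _.
move=> x x_incr x_roots x_last u.
have x_le0 k : x k <= 0.
  rewrite -(x_last ord_max erefl).
  have := leq_ord k; rewrite leq_eqVlt => /predU1P[kn|kn]; last first.
    by apply/ltW/x_incr.
  by rewrite (_ : k = ord_max) //; exact: val_inj.
have x1_ge1 k : 1 <= 1 - x k by rewrite lerDl oppr_ge0.
have x1_gt0 k : 0 < 1 - x k by rewrite (lt_le_trans ltr01).
split=> [k|[//|p] /= lt_pn].
  by rewrite /u div1r invr_gt0 x1_gt0 invf_le1 ?x1_ge1 ?x1_gt0.
have x_inj : injective x.
  move=> i j xij; apply: val_inj; case: (ltngtP i j) => // ij.
    by have := x_incr _ _ ij; rewrite xij ltxx.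
  by have := x_incr _ _ ij; rewrite xij ltxx.
pose A := eulerian_poly R n.+1.
have A1 : A.[1] != 0.
  have := eulerian_rec_comp0 R n.+1.
  rewrite -eulerian_poly_rec -/A horner_comp hornerD hornerN hornerC hornerX.
  rewrite subr0 => ->.
  by rewrite pnatr_eq0 -lt0n fact_gt0.
have A0 : A != 0 by apply: contraNneq A1 => ->; rewrite horner0.
have A_roots : all (root A) (codom x).
  by apply/allP => _ /codomP[k ->]; apply/x_roots; exists k.
have uniq_x : uniq (codom x) by exact/injectiveP.
(* The distinct roots force the degree up to its upper bound, so [A] splits into these simple linear
   factors. *)
have size_A : size A = (size (codom x)).+1.
  apply/eqP; rewrite eqn_leq max_poly_roots // andbT size_codom card_ord.
  exact: size_eulerian_poly.
have := all_roots_prod_XsubC size_A A_roots; rewrite uniq_rootsE => /(_ uniq_x).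
rewrite /codom /image_mem big_map big_enum /= => AE.
(* Each factor becomes 1 - t - x_k = (1 - x_k) (1 - u_k t). *)
have CE : eulerian_rec R n.+1 \Po (1 - 'X) =
    (lead_coef A * \prod_(k < n.+1) (1 - x k))%:P
      * \prod_(k < n.+1) (1 - (u k)%:P * 'X).
  rewrite -eulerian_poly_rec -/A {1}AE comp_polyZ -mul_polyC rmorphM -mulrA.
  congr (_ * _); rewrite [LHS]rmorph_prod rmorph_prod -big_split /=.
  apply: eq_bigr => k _; rewrite comp_polyB comp_polyX comp_polyC.
  rewrite mulrBr mulr1 mulrA -rmorphM /u mul1r divff ?gt_eqF //.
  by rewrite rmorphB !rmorph1 mul1r addrAC.
rewrite (eulerian_power_sums CE) // -norlund_binom_poly.
by rewrite mulrA div1r mulVf ?mul1r // pnatr_eq0.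
Qed.
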